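(* Let $A$ be a positive information algebra, let $L$ be a join-semilattice disjoint from $A$, and let $S=A\uplus_{\mathrm{ord}}L$ be the overflow semiring. Then $S$ is austere, i.e. the only subtractive ideals of $S$ are $\{0\}$ and $S$.
   Context: All semirings are commutative: $(S,+,0)$ and $(S,\cdot,1)$ are commutative monoids, $1\neq 0$, multiplication distributes over addition, and $0$ is absorbing. A semiring is zerosumfree if $a+b=0$ implies $a=b=0$, and entire if $ab=0$ implies $a=0$ or $b=0$; an information algebra is a zerosumfree entire semiring. A positive information algebra is an information algebra with a partial order $\leq$ compatible with $+$ and $\cdot$ (i.e. $x\leq y$ implies $x+z\leq y+z$ and $xz\leq yz$) and having $0$ as least element. An ideal of a semiring $S$ is a nonempty subset $I$ with $a+b\in I$ and $sa\in I$ for all $a,b\in I$, $s\in S$. An ideal $I$ is subtractive if $x+y\in I$ and $x\in I$ imply $y\in I$ for all $x,y\in S$. Overflow semiring $S=A\uplus_{\mathrm{ord}}L$: for a positive information algebra $A$ and a join-semilattice $L$ disjoint from $A$, $S=A\cup L$ with the order extending those of $A$ and $L$ by $a\leq\ell$ for all $a\in A,\ell\in L$ (and never $\ell\leq a$), and operations: $x+y=x+_Ay$ if $x,y\in A$, $x+y=\sup\{x,y\}$ otherwise; $xy=x\cdot_Ay$ if $x,y\in A\setminus\{0\}$, $xy=0$ if $x=0$ or $y=0$, and $xy=\sup\{x,y\}$ otherwise. With these, $S$ is a positive information algebra. *)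

(* Defs.v *)
From HB Require Import structures.
From mathcomp Require Import all_boot all_order all_algebra.
From mathcomp Require Import boolp classical_sets.

Set Implicit Arguments.
Unset Strict Implicit.
Unset Printing Implicit Defensive.

Import Order.TTheory GRing.Theory.

Local Open Scope classical_set_scope.
Local Open Scope ring_scope.

HB.mixin Record isInformationAlgebra R of GRing.ComNzSemiRing R := {
  zerosumfree : forall x y : R, x + y = 0 -> x = 0 /\ y = 0;
  entire : forall x y : R, x * y = 0 -> x = 0 \/ y = 0
}.

#[short(type="informationAlgebraType")]
HB.structure Definition InformationAlgebra :=
  { R of isInformationAlgebra R & GRing.ComNzSemiRing R }.

(* The order is a field of the structure, not an Order.POrder instance: a
   structure inheriting from both Order.POrder and GRing.Nmodule but not from
   Num.POrderedZmodule is rejected by Hierarchy Builder. *)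
HB.mixin Record isPositive R of InformationAlgebra R := {
  pia_le : rel R;
  pia_le_refl : reflexive pia_le;
  pia_le_anti : antisymmetric pia_le;
  pia_le_trans : transitive pia_le;
  pia_leD2r : forall x y z : R, pia_le x y -> pia_le (x + z) (y + z);
  pia_leM2r : forall x y z : R, pia_le x y -> pia_le (x * z) (y * z);
  pia_le0x : forall x : R, pia_le 0 x
}.

#[short(type="positiveInformationAlgebraType")]
HB.structure Definition PositiveInformationAlgebra :=
  { R of isPositive R & InformationAlgebra R }.

Notation "x =<= y" := (pia_le x y) (at level 70, no associativity) : ring_scope.

Definition is_ideal (S : comNzSemiRingType) (I : set S) : Prop :=
  [/\ I !=set0,
      forall a b, I a -> I b -> I (a + b)
    & forall s a, I a -> I (s * a)].

Definition subtractive (S : comNzSemiRingType) (I : set S) : Prop :=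
  forall x y, I (x + y) -> I x -> I y.

Definition austere (S : comNzSemiRingType) : Prop :=
  forall I : set S, is_ideal I /\ subtractive I <-> I = [set 0] \/ I = setT.

(* The sum type encodes A and L being disjoint; the alias keeps the instances
   below off the bare sum type. *)
Definition overflow d (A : positiveInformationAlgebraType)
    (L : joinSemilatticeType d) : Type := (A + L)%type.

Section OverflowTheory.
Variables (d : Order.disp_t).
Variables (A : positiveInformationAlgebraType) (L : joinSemilatticeType d).
Local Notation S := (overflow A L).

HB.instance Definition _ := Choice.copy S (A + L)%type.

Definition overflow_le (x y : S) : bool :=
  match x, y with
  | inl a, inl b => a =<= b
  | inl _, inr _ => true
  | inr _, inl _ => false
  | inr l, inr m => (l <= m)%O
  end.

Fact overflow_le_refl : reflexive overflow_le.
Proof. by case=> x /=; [apply: pia_le_refl|apply: lexx]. Qed.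

Fact overflow_le_anti : antisymmetric overflow_le.
Proof. by case=> x [] y //=; [move/pia_le_anti->|move/le_anti->]. Qed.

Fact overflow_le_trans : transitive overflow_le.
Proof. by case=> x [] y [] z //=; [apply: pia_le_trans|apply: le_trans]. Qed.

(* Off A, the value is sup {x, y} for the order above: overflow_add_sup. *)
Definition overflow_add (x y : S) : S :=
  match x, y with
  | inl a, inl b => inl (a + b)
  | inl _, inr m => inr m
  | inr l, inl _ => inr l
  | inr l, inr m => inr (l `|` m)%O
  end.

(* Off A and away from 0, the value is sup {x, y}: overflow_mul_sup. *)
Definition overflow_mul (x y : S) : S :=
  match x, y with
  | inl a, inl b => inl (a * b)
  | inl a, inr m => if a == 0 then inl 0 else inr m
  | inr l, inl b => if b == 0 then inl 0 else inr l
  | inr l, inr m => inr (l `|` m)%O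
  end.

Fact overflow_addA : associative overflow_add.
Proof.
by case=> x [] y [] z //=; rewrite ?addrA ?joinA.
Qed.

Fact overflow_addC : commutative overflow_add.
Proof. by case=> x [] y //=; rewrite 1?addrC 1?joinC. Qed.

Fact overflow_add0 : left_id (inl 0 : S) overflow_add.
Proof. by case=> x //=; rewrite add0r. Qed.

HB.instance Definition _ := GRing.isNmodule.Build S
  overflow_addA overflow_addC overflow_add0.

Let add_eq0 (a b : A) : (a + b == 0) = (a == 0) && (b == 0).
Proof.
apply/eqP/andP => [/zerosumfree[-> ->]|[/eqP-> /eqP->]]; last by rewrite addr0.
by rewrite eqxx.
Qed.

Let mul_eq0 (a b : A) : (a * b == 0) = (a == 0) || (b == 0).
Proof.
apply/eqP/orP => [/entire[]->|[]/eqP->]; rewrite ?eqxx ?mul0r ?mulr0; auto.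
Qed.

Fact overflow_mulA : associative overflow_mul.
Proof.
case=> x [] y [] z //=; rewrite ?mulrA ?joinA ?mul_eq0 //=;
by do ?[case: (_ =P 0) => //= ?]; subst; rewrite ?mul0r ?mulr0.
Qed.

Fact overflow_mulC : commutative overflow_mul.
Proof. by case=> x [] y //=; rewrite 1?mulrC 1?joinC. Qed.

Fact overflow_mul1 : left_id (inl 1 : S) overflow_mul.
Proof. by case=> x //=; rewrite ?mul1r ?oner_eq0. Qed.

Fact overflow_mulDl : left_distributive overflow_mul overflow_add.
Proof.
case=> x [] y [] z //=; rewrite ?mulrDl ?add_eq0 //=;
do ?[case: (_ =P 0) => //= ?]; subst; rewrite ?addr0 ?mulr0 ?joinxx //.
- by rewrite joinCA joinxx.
- by rewrite addr0.
- by rewrite -joinA joinxx.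
- by rewrite joinACA joinxx.
Qed.

Fact overflow_mul0 : left_zero (inl 0 : S) overflow_mul.
Proof. by case=> x //=; rewrite ?mul0r ?eqxx. Qed.

Fact overflow_1neq0 : (inl 1 : S) != (inl 0 : S).
Proof. by apply/eqP => -[] /eqP; rewrite oner_eq0. Qed.

HB.instance Definition _ := GRing.Nmodule_isComNzSemiRing.Build S
  overflow_mulA overflow_mulC overflow_mul1 overflow_mulDl overflow_mul0
  overflow_1neq0.

Lemma overflow_addE (x y : S) : x + y = overflow_add x y. Proof. by []. Qed.

Lemma overflow_mulE (x y : S) : x * y = overflow_mul x y. Proof. by []. Qed.

Fact overflow_zerosumfree (x y : S) : x + y = 0 -> x = 0 /\ y = 0.
Proof. by case: x y => x [] y // [] /zerosumfree[-> ->]. Qed.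

Fact overflow_entire (x y : S) : x * y = 0 -> x = 0 \/ y = 0.
Proof.
rewrite overflow_mulE; case: x y => x [] y //=.
- by case=> /entire[]->; [left|right].
- by case: eqP => // -> _; left.
- by case: eqP => // -> _; right.
Qed.

HB.instance Definition _ := isInformationAlgebra.Build S
  overflow_zerosumfree overflow_entire.

Fact overflow_leD2r (x y z : S) :
  overflow_le x y -> overflow_le (x + z) (y + z).
Proof.
case: x y z => x [] y [] z //=; rewrite ?leUr ?lexx //.
- exact: pia_leD2r.
- by move=> xy; apply: leU2.
Qed.

Fact overflow_leM2r (x y z : S) :
  overflow_le x y -> overflow_le (x * z) (y * z).
Proof.
rewrite !overflow_mulE; case: x y z => x [] y [] z //=.
- exact: pia_leM2r.
- move=> xy; case: (eqVneq y 0) xy => [->|_ _].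
    move=> x0; rewrite (_ : x == 0) /= ?pia_le_refl //.
    by apply/eqP/pia_le_anti; rewrite x0 pia_le0x.
  by case: eqP => //= _; rewrite lexx.
- by case: eqVneq => [->|//] _; rewrite mulr0 /= pia_le_refl.
- by case: eqP => //= _ _; rewrite leUr.
- by case: eqP => //= _ _; rewrite pia_le_refl.
- by move=> xy; apply: leU2.
Qed.

Fact overflow_le0x (x : S) : overflow_le 0 x.
Proof. by case: x => x //=; apply: pia_le0x. Qed.

HB.instance Definition _ := isPositive.Build S
  overflow_le_refl overflow_le_anti overflow_le_trans
  overflow_leD2r overflow_leM2r overflow_le0x.

Definition in_algebra (x : S) : bool := if x is inl _ then true else false.

Definition is_sup (x y s : S) : Prop :=
  [/\ x =<= s, y =<= s & forall z, x =<= z -> y =<= z -> s =<= z].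

Lemma overflow_add_sup (x y : S) :
  ~~ (in_algebra x && in_algebra y) -> is_sup x y (x + y).
Proof.
case: x y => x [] y //= _; split; rewrite /pia_le /= ?leUl ?leUr ?lexx //.
by case=> z //=; rewrite leUx => -> ->.
Qed.

Lemma overflow_mul_sup (x y : S) : x != 0 -> y != 0 ->
  ~~ (in_algebra x && in_algebra y) -> is_sup x y (x * y).
Proof.
move=> x0 y0 xy; suff -> : x * y = x + y by exact: overflow_add_sup.
rewrite overflow_mulE overflow_addE; case: x y x0 y0 xy => x [] y //=.
- by case: (x =P 0) => // -> /eqP[].
- by case: (y =P 0) => // -> _ /eqP[].
Qed.

End OverflowTheory.

(* Main.v *)
(** A subtractive ideal containing an element [u] with [u + 1 = u] contains [1],
    hence is everything. In the overflow semiring every element of [L] absorbs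
    [1] in this way, and every nonzero element has a multiple in [L]. *)

Require Import Defs.
From HB Require Import structures.
From mathcomp Require Import all_boot all_order all_algebra.
From mathcomp Require Import boolp classical_sets.
Local Open Scope classical_set_scope.

Import GRing.Theory.

Lemma is_ideal0 (S : comNzSemiRingType) : is_ideal [set (0%R : S)].
Proof.
split; first by exists 0%R.
- by move=> a b -> ->; rewrite /= addr0.
- by move=> s a ->; rewrite /= mulr0.
Qed.

Lemma subtractive0 (S : comNzSemiRingType) : subtractive [set (0%R : S)].
Proof. by move=> x y /= xy0 x0; move: xy0; rewrite x0 add0r. Qed.

Lemma is_idealT (S : comNzSemiRingType) : is_ideal [set: S].
Proof. by split=> //; exists 0%R. Qed.

Lemma is_ideal_mem0 (S : comNzSemiRingType) (I : set S) : is_ideal I -> I 0%R.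
Proof. by case=> -[x Ix] _ IM; rewrite -(mul0r x); apply: IM. Qed.

Lemma is_ideal_mem1 (S : comNzSemiRingType) (I : set S) :
  is_ideal I -> I 1%R -> I = setT.
Proof.
by case=> _ _ IM I1; apply/seteqP; split=> // x _; rewrite -(mulr1 x); apply: IM.
Qed.

(** Ideals are closed under multiples, so it is enough that some multiple of [x], rather than [x]
    itself, absorbs [1]. *)
Lemma austere_absorb1 (S : comNzSemiRingType) :
  (forall x : S, x != 0%R -> exists s : S, (s * x + 1 = s * x)%R) -> austere S.
Proof.
move=> absorb1 I; split=> [[idI subI]|[]->]; last 2 first.
- by split; [apply: is_ideal0|apply: subtractive0].
- by split; first exact: is_idealT.
case: (pselect (I `<=` [set 0%R])) => [I0|/existsNP[x /not_implyP[Ix x0]]].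
  left; apply/seteqP; split=> // _ ->; exact: is_ideal_mem0.
right; apply: is_ideal_mem1 => //.
have [s sx1] := absorb1 x (introN eqP x0).
have Isx : I (s * x)%R by case: idI => _ _; apply.
(* Subtractivity cancels [s * x] from [s * x + 1], which lies in [I] because it equals [s * x]. *)
by apply: (subI (s * x)%R) => //; rewrite sx1.
Qed.

Theorem proposition4p1 (d : Order.disp_t)
    (A : positiveInformationAlgebraType) (L : joinSemilatticeType d)
    (L_nonempty : [set: L] !=set0) :
  austere (overflow A L).
Proof.
(* Any [l] serves every [x]: the product is [inr l] for nonzero [x] in [A] and a join in [L]
   otherwise, and adding [1], which lies in [A], leaves elements of [L] fixed. *)
case: L_nonempty => l _; apply: austere_absorb1 => x x0; exists (inr l).
rewrite overflow_addE overflow_mulE; case: x x0 => [a|m] //= a0.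
(* The zero branch of the product contradicts [a0]. *)
by case: (a =P 0%R) a0 => // -> /eqP[].
Qed.
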